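(* Let $\mathcal S$ be any control semigroup and let $X,Y$ be any two metric spaces. If there exists a $\Sigma(\mathcal S)$-coarse embedding $f:X\to Y$, then $asdim_{\mathcal S}X\le asdim_{\mathcal S}Y$.
   Context: $\mathbb R_+=[0,\infty)$. A property $P(s)$ of positive reals holds in a neighborhood of $\infty$ if there is $s_0$ such that it holds for all $s\ge s_0$. An asymptotic (large scale) dim-control function is an increasing continuous $f:\mathbb R_+\to\mathbb R_+$ with $f(x)\ge x$ in a neighborhood of $\infty$ and $\lim_{x\to\infty}f(x)=\infty$; it is asymptotically linear if it equals some linear function in a neighborhood of $\infty$. A (large scale) control semigroup is a set $\mathcal S$ of asymptotic dim-control functions containing every asymptotically linear dim-control function and closed under composition. A family of subsets of a metric space is $s$-disjoint if $d(U,V)>s$ for any two distinct members $U,V$, and $C$-bounded if every member has diameter $\le C$. $asdim_{\mathcal S}X\le n$ means there is $f\in\mathcal S$ such that for every $s$ in some neighborhood of $\infty$ there is a cover $\mathcal U=\bigcup_{i=1}^{n+1}\mathcal U_i$ of $X$ with each $\mathcal U_i$ $s$-disjoint and $f(s)$-bounded; $asdim_{\mathcal S}X$ is the least such $n$ ($\infty$ if none). A (large scale) metric perturbation set $\mathcal Q$ is a set of positive real continuous increasing functions $\rho$ with $\rho(\infty)=\infty$ (i.e. $\lim_{x\to\infty}\rho(x)=\infty$). A function $f:X\to Y$ between metric spaces is a $\mathcal Q$-coarse embedding if there are functions $\rho_-,\rho_+$ with $\rho_-^{-1},\rho_+\in\mathcal Q$ such that $\rho_-(d_X(x,y))\le d_Y(f(x),f(y))\le\rho_+(d_X(x,y))$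 for all $x,y\in X$. The metric perturbation set $\Sigma(\mathcal S)$ generated by $\mathcal S$ is the set of all continuous increasing functions $\rho$ with $\lim_{x\to\infty}\rho(x)=\infty$ for which there is $g\in\mathcal S$ with $g\ge\rho$ in a neighborhood of $\infty$. *)

(* Defs.v *)
From mathcomp Require Import all_boot all_order all_algebra.
From mathcomp Require Import all_classical all_reals all_analysis.

Set Implicit Arguments.
Unset Strict Implicit.
Unset Printing Implicit Defensive.

Import Order.TTheory GRing.Theory Num.Theory.
Import numFieldNormedType.Exports.
Local Open Scope classical_set_scope.
Local Open Scope ring_scope.

(* A function R_+ -> R_+ is represented by a function R -> R whose values on
   negative reals are irrelevant.  "Increasing" is strict, since inverses of
   such functions are used below. *)
Definition large_scale_function (R : realType) (f : R -> R) : Prop :=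
  [/\ forall x, 0 <= x -> 0 <= f x,
      {within `[0, +oo[, continuous f},
      forall x y, 0 <= x -> x < y -> f x < f y
    & f x @[x --> +oo] --> +oo].

Definition dim_control (R : realType) (f : R -> R) : Prop :=
  large_scale_function f /\ \forall x \near +oo, x <= f x.

(* "Linear" is x |-> a * x.  With affine functions instead, a control semigroup
   would have to contain more functions, so every control semigroup in that
   sense is also one in the sense below. *)
Definition asymptotically_linear (R : realType) (f : R -> R) : Prop :=
  exists a : R, \forall x \near +oo, f x = a * x.

Definition control_semigroup (R : realType) (S : set (R -> R)) : Prop :=
  [/\ forall f, S f -> dim_control f,
      forall f, dim_control f -> asymptotically_linear f -> S f
    & forall f g, S f -> S g -> S (f \o g)].

(* Equal to +oo when A or B is empty. *)
Definition set_dist (R : realType) (X : metricType R) (A B : set X) : \bar R :=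
  ereal_inf [set (mdist x y)%:E | x in A & y in B].

(* The maximum with 0 only matters for the empty set. *)
Definition diam (R : realType) (X : metricType R) (A : set X) : \bar R :=
  maxe 0%E (ereal_sup [set (mdist x y)%:E | x in A & y in A]).

Definition disjoint_family (R : realType) (X : metricType R) (s : R)
    (U : set (set X)) : Prop :=
  forall A B, U A -> U B -> A <> B -> (s%:E < set_dist A B)%E.

Definition bounded_family (R : realType) (X : metricType R) (C : R)
    (U : set (set X)) : Prop :=
  forall A, U A -> (diam A <= C%:E)%E.

Definition asdim_le (R : realType) (S : set (R -> R)) (X : metricType R)
    (n : nat) : Prop :=
  exists2 f, S f &
    \forall s \near +oo, exists U : 'I_n.+1 -> set (set X),
      cover (\bigcup_i U i) id = [set: X] /\
      forall i, disjoint_family s (U i) /\ bounded_family (f s) (U i).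

Definition asdim (R : realType) (S : set (R -> R)) (X : metricType R) : \bar R :=
  ereal_inf [set n%:R%:E | n in [set n | asdim_le S X n]].

Definition metric_perturbation_set (R : realType) (Q : set (R -> R)) : Prop :=
  forall rho, Q rho -> large_scale_function rho.

(* g : R_+ -> R_+ is the inverse of rho.  The function rho is allowed to take
   negative values, on which g is not defined: this happens for the function
   t / L - C of a quasi-isometric embedding, whose inverse is L * (s + C).
   If rho is nonnegative on R_+, then g is the inverse of a bijection of R_+. *)
Definition inverse_on_nonneg (R : realType) (rho g : R -> R) : Prop :=
  forall s t, 0 <= s -> 0 <= t -> g s = t <-> rho t = s.

Definition coarse_embedding (R : realType) (Q : set (R -> R))
    (X Y : metricType R) (f : X -> Y) : Prop :=
  exists rho_m rho_m_inv rho_p : R -> R,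
    [/\ inverse_on_nonneg rho_m rho_m_inv, Q rho_m_inv, Q rho_p
      & forall x y, rho_m (mdist x y) <= mdist (f x) (f y) <= rho_p (mdist x y)].

Definition generated_perturbation_set (R : realType) (S : set (R -> R)) :
    set (R -> R) :=
  [set rho | large_scale_function rho /\
    exists2 g, S g & \forall x \near +oo, rho x <= g x].

Lemma generated_perturbation_setP (R : realType) (S : set (R -> R)) :
  metric_perturbation_set (generated_perturbation_set S).
Proof. by move=> rho []. Qed.

(* Main.v *)
Require Import Defs.
From mathcomp Require Import all_boot all_order all_algebra.
From mathcomp Require Import all_classical all_reals all_analysis.

Set Implicit Arguments.
Unset Strict Implicit.
Unset Printing Implicit Defensive.

Import Order.TTheory GRing.Theory Num.Theory.
Import numFieldNormedType.Exports.
Local Open Scope classical_set_scope.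
Local Open Scope ring_scope.

(** If [rho_m (d x y) <= d (f x) (f y) <= rho_p (d x y)], then pulling back
    along [f] a cover of [Y] that is [rho_p (2 s)]-disjoint and [C]-bounded
    gives a cover of [X] that is [s]-disjoint and [rho_m^-1 C]-bounded. If
    [g_p >= rho_p] and [g_m >= rho_m^-1] are taken from the semigroup and [h]
    is a dimension control function for [Y], then [s |-> g_m (h (g_p (2 s)))]
    belongs to the semigroup and is a control function for [X]. *)

Lemma large_scale_function_le (R : realType) (f : R -> R) (x y : R) :
  large_scale_function f -> 0 <= x -> x <= y -> f x <= f y.
Proof.
move=> [_ _ f_incr _] x0; rewrite le_eqVlt => /predU1P[-> //|xy].
exact/ltW/f_incr.
Qed.

(** With [a = 2] this puts doubling into every control semigroup, since doubling is linear. *)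
Lemma dim_control_scale (R : realType) (a : R) :
  1 <= a -> dim_control (fun x => a * x).
Proof.
move=> a1; have a0 : 0 < a by exact: lt_le_trans a1.
split; first split.
- by move=> x x0; rewrite mulr_ge0// ltW.
- by apply: continuous_subspaceT => x; exact: mulrl_continuous.
- by move=> x y _ xy; rewrite ltr_pM2l.
- exact: gt0_cvgMry.
- by near=> x; rewrite ler_peMl.
Unshelve. all: by end_near.
Qed.

(* [rho] need not be monotone on the reals where it is negative, so the bound
   comes from the surjectivity of [g] onto [[g 0, +oo[]. *)
Lemma le_inverse_on_nonneg (R : realType) (rho g : R -> R) (d t : R) :
  inverse_on_nonneg rho g -> large_scale_function g ->
  0 <= d -> 0 <= t -> rho d <= t -> d <= g t.
Proof.
move=> rho_g g_ls d0 t0 rho_d; have [_ g_cont _ gy] := g_ls.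
(* If [d <= g 0], then [d] may lie outside the range of [g], but monotonicity of [g] suffices. *)
have [d_le|g0_lt] := leP d (g 0).
  exact/(le_trans d_le)/large_scale_function_le.
have [b [b0 d_le_gb]] : exists b, 0 <= b /\ d <= g b.
  near +oo_R => b; exists b; split; near: b.
    exact/nbhs_pinfty_ge/num_real.
  by move/cvgryPge : gy; exact.
(* The intermediate value theorem gives [u >= 0] with [g u = d]; hence [u = rho d <= t], and [g] is
   increasing. *)
have [||u] := @IVT R g 0 b d b0.
- apply: continuous_subspaceW g_cont => x /=.
  by rewrite !in_itv/= => /andP[->].
- by rewrite ge_min le_max (ltW g0_lt) d_le_gb orbT.
- rewrite in_itv/= => /andP[u0 _] gu; rewrite -gu.
  apply: large_scale_function_le => //.
  by rewrite -((rho_g u d u0 d0).1 gu).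
Unshelve. all: by end_near.
Qed.

Lemma mdist_le_diam (R : realType) (X : metricType R) (A : set X) (x y : X) :
  A x -> A y -> ((mdist x y)%:E <= diam A)%E.
Proof.
move=> Ax Ay; rewrite /diam le_max; apply/orP; right.
by apply: ereal_sup_ubound; exists x => //; exists y.
Qed.

Lemma set_dist_le_mdist (R : realType) (X : metricType R) (A B : set X)
    (x y : X) :
  A x -> B y -> (set_dist A B <= (mdist x y)%:E)%E.
Proof.
by move=> Ax By; apply: ereal_inf_lbound; exists x => //; exists y.
Qed.

Section preimage_family.
Context (R : realType) (X Y : metricType R) (f : X -> Y).

(** The gap [s < s'] is needed because [set_dist] is an infimum: the pointwise bounds
    [s' < mdist x y] only give [s' <= set_dist]. *)
Lemma disjoint_family_preimage (s s' t : R) (V : set (set Y)) :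
  s < s' -> (forall x y, mdist x y <= s' -> mdist (f x) (f y) <= t) ->
  disjoint_family t V -> disjoint_family s [set f @^-1` B | B in V].
Proof.
move=> ss' f_le Vt _ _ [A VA <-] [B VB <-] AB.
apply: (@lt_le_trans _ _ s'%:E); first by rewrite lte_fin.
apply: le_ereal_inf_tmp => _ [x Ax [y By <-]]; rewrite lee_fin leNgt.
apply/negP => /ltW /f_le; apply/negP; rewrite -ltNge -lte_fin.
apply: (lt_le_trans (Vt A B VA VB _)); first by move=> eqAB; rewrite eqAB in AB.
exact: set_dist_le_mdist.
Qed.

(** The condition [0 <= D] answers the maximum with 0 in [diam]; the other argument is bounded
    pairwise. *)
Lemma bounded_family_preimage (C D : R) (V : set (set Y)) :
  0 <= D -> (forall x y, mdist (f x) (f y) <= C -> mdist x y <= D) ->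
  bounded_family C V -> bounded_family D [set f @^-1` B | B in V].
Proof.
move=> D0 f_ge VC _ [B VB <-]; rewrite /diam ge_max lee_fin D0/=.
apply: ge_ereal_sup => _ [x Bx [y By <-]]; rewrite lee_fin f_ge//.
by rewrite -lee_fin (le_trans _ (VC B VB))// mdist_le_diam.
Qed.

Lemma cover_preimage (n : nat) (V : 'I_n -> set (set Y)) :
  cover (\bigcup_i V i) id = [set: Y] ->
  cover (\bigcup_i [set f @^-1` B | B in V i]) id = [set: X].
Proof.
move=> V_cover; apply/seteqP; split => // x _.
have [B [i _ ViB] Bfx] : cover (\bigcup_i V i) id (f x) by rewrite V_cover.
by exists (f @^-1` B) => //; exists i => //; exists B.
Qed.

End preimage_family.

Lemma asdim_le_coarse_embedding (R : realType) (S : set (R -> R))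
    (X Y : metricType R) (f : X -> Y) (n : nat) :
  control_semigroup S ->
  coarse_embedding (generated_perturbation_set S) f ->
  asdim_le S Y n -> asdim_le S X n.
Proof.
move=> [S_dc S_lin S_comp].
move=> [rho_m [inv_m [rho_p [rho_m_inv [inv_m_ls [g_m Sg_m inv_le]]
  [rho_p_ls [g_p Sg_p rho_p_le]] f_bound]]]] [h Sh h_cover].
(* Any factor above 1 would give the strict gap [s < dbl s] required for disjointness of the
   preimages. *)
pose dbl := fun x : R => 2 * x.
have Sdbl : S dbl.
  apply: S_lin; first by apply: dim_control_scale; rewrite ler1n.
  by exists 2; near=> x.
have Sk : S (g_p \o dbl) by exact: S_comp.
have Shk : S (h \o (g_p \o dbl)) by exact: S_comp.
have Sghk : S (g_m \o (h \o (g_p \o dbl))) by exact: S_comp.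
have ls u : S u -> large_scale_function u by move=> /S_dc[].
have ge0 u x : S u -> 0 <= x -> 0 <= u x by move=> /ls[+ _ _ _]; exact.
have oo u : S u -> u x @[x --> +oo] --> +oo by move=> /ls[].
exists (g_m \o (h \o (g_p \o dbl))) => //.
near=> s.
have s0 : 0 < s by near: s; exact/nbhs_pinfty_gt/num_real.
(* The comparisons of [rho_p] with [g_p] and of [inv_m] with [g_m], and the covers of [Y], are
   available only near infinity. Each is used at an argument that tends to infinity with [s]. *)
have /= rho_p_dbl : rho_p (dbl s) <= g_p (dbl s).
  by near: s; exact: (oo _ Sdbl _ rho_p_le).
have /= inv_hk : inv_m ((h \o (g_p \o dbl)) s) <= g_m ((h \o (g_p \o dbl)) s).
  by near: s; exact: (oo _ Shk _ inv_le).
have [V [V_cover V_fam]] : exists V : 'I_n.+1 -> set (set Y),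
    cover (\bigcup_i V i) id = [set: Y] /\
    forall i, disjoint_family ((g_p \o dbl) s) (V i) /\
              bounded_family (h ((g_p \o dbl) s)) (V i).
  by near: s; exact: (oo _ Sk _ h_cover).
exists (fun i => [set f @^-1` B | B in V i]); split; first exact: cover_preimage.
move=> i; have [V_disj V_bd] := V_fam i; split.
- apply: (disjoint_family_preimage (s' := dbl s)) V_disj.
    by rewrite -[ltLHS]mul1r ltr_pM2r// ltr1n.
  move=> x y xy; have /andP[_ f_le] := f_bound x y.
  apply: le_trans f_le (le_trans _ rho_p_dbl).
  by apply: large_scale_function_le; rewrite ?mdist_ge0.
- apply: bounded_family_preimage V_bd; first exact: (ge0 _ _ Sghk (ltW s0)).
  move=> x y fxy; apply: le_trans inv_hk.
  apply: (le_inverse_on_nonneg rho_m_inv) => //.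
  + exact: mdist_ge0.
  + exact: (ge0 _ _ Shk (ltW s0)).
  + by have /andP[f_ge _] := f_bound x y; exact: le_trans f_ge fxy.
Unshelve. all: by end_near.
Qed.

Theorem corollary6p7 (R : realType) (S : set (R -> R)) (X Y : metricType R) :
  control_semigroup S ->
  (exists f : X -> Y, coarse_embedding (generated_perturbation_set S) f) ->
  (asdim S X <= asdim S Y)%E.
Proof.
(* Every [n] admissible for [Y] is admissible for [X], so the infimum for [X] is over a larger set;
   this includes the infinite case. *)
move=> S_semigroup [f f_coarse]; apply: ereal_inf_le_tmp => _ [n nY <-].
exists n => //; exact: (asdim_le_coarse_embedding S_semigroup f_coarse nY).
Qed.
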